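(* There exists a graph $\mathcal{G}$ which is locally constructible, but is not a weak cop win.
   Context: Graphs are undirected, loopless and connected. A vertex $u$ dominates a vertex $v\neq u$ in a graph if the set consisting of $v$ and all neighbours of $v$ is contained in the set consisting of $u$ and all neighbours of $u$. A finite graph $H$ is constructible if there is an ordering $x_1,\ldots,x_n$ of its vertices such that for every $k>1$, in the induced graph $H[x_1,\ldots,x_k]$ the vertex $x_k$ is dominated by $x_i$ for some $i<k$. A graph $G$ is locally constructible if for every finite set of vertices $V$ there is a finite set of vertices $U$ containing $V$ such that the induced graph $G[U]$ is constructible. Cops and robbers: on a graph $G$ the cop picks a starting vertex, then the robber picks a starting vertex; then they move alternately, with the cop moving first. At each turn the player moves to an adjacent vertex or does not move. The cop catches the robber if he lands on the robber's vertex. $G$ is a weak cop win if there is a strategy for the cop that guarantees that either the cop catches the robber or, for every vertex, the robber visits that vertex only finitely often. *)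

(* Defs.v *)
(* MathComp world, with finmap's finite sets and mathcomp-classical's
   [finite_set]. *)
From mathcomp Require Import all_boot finmap.
From mathcomp Require Import classical_sets cardinality.

Set Implicit Arguments.
Unset Strict Implicit.
Unset Printing Implicit Defensive.

Local Open Scope fset_scope.

(* The vertex set may be infinite.  Nonemptiness is part of connectedness:
   without it the empty graph would be locally constructible and, the cop
   having no vertex to start from, not a weak cop win. *)
Record graph := Graph {
  vertex :> choiceType;
  adj : rel vertex;
  adj_sym : symmetric adj;
  adj_irrefl : irreflexive adj;
  graph_nonempty : inhabited vertex;
  graph_connected :
    forall u v : vertex, exists2 p : seq vertex, path adj u p & last u p = v
}.

Section Constructible.
Variable G : graph.
Implicit Types (A U : {fset G}) (u v : G).

(* The closed neighbourhood of v in the induced graph G[A], for v \in A. *)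
Definition closed_nbhd A v : {fset G} := [fset w in A | (w == v) || adj v w].

Definition dominates A u v : Prop :=
  [/\ u \in A, v \in A, u != v & closed_nbhd A v `<=` closed_nbhd A u].

(* G[U] is constructible.  Vertices are numbered from 0, so "k > 1" is
   [0 < k], and [x_1, ..., x_k] becomes the indices [<= k]. *)
Definition constructible U : Prop :=
  exists (n : nat) (x : 'I_n -> G),
    [/\ injective x, [fset x i | i : 'I_n] = U &
        forall k : 'I_n, 0 < k ->
          exists2 i : 'I_n, i < k &
            dominates [fset x j | j : 'I_n & j <= k] (x i) (x k)].

Definition locally_constructible : Prop :=
  forall A, exists2 U, A `<=` U & constructible U.

End Constructible.

Section Game.
Variable G : graph.

Definition legal_walk (w : nat -> G) : Prop :=
  forall n, (w n.+1 == w n) || adj (w n) (w n.+1).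

(* A cop strategy is a function of the list of robber positions so far (the
   cop's own past positions are determined by it).  The play is
     cop 0, r 0, cop 1, r 1, cop 2, ...
   where [cop n = s [:: r 0; ...; r n.-1]]; in particular [s [::]] is the
   starting vertex. *)
Definition cop_strategy := seq G -> G.

Definition cop (s : cop_strategy) (r : nat -> G) (n : nat) : G :=
  s (mkseq r n).

(* Requiring legality after a capture is harmless: the cop may then stay put. *)
Definition legal_strategy (s : cop_strategy) : Prop :=
  forall r, legal_walk r -> legal_walk (cop s r).

(* The cop's move number n.+1 answers the robber's position [r n].  A robber who
   steps onto the cop's vertex is caught by the cop not moving. *)
Definition caught (s : cop_strategy) (r : nat -> G) : Prop :=
  exists n, cop s r n.+1 = r n.

Definition visits_finitely_often (r : nat -> G) (v : G) : Prop :=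
  finite_set [set n | r n = v]%classic.

Definition weak_cop_win : Prop :=
  exists2 s, legal_strategy s &
    forall r, legal_walk r ->
      caught s r \/ forall v, visits_finitely_often r v.

End Game.

(* Main.v *)
(* Any finite set of vertices lies in a finite set in which [Apex] dominates all
   vertices except the two limit poles [Pole i None], and [Pole i None] is
   dominated by [Pole i (Some n)] for n large: such a set is constructible.
   The robber stays on the limit poles and the spokes.  Only a pole on the same
   side or a spoke can threaten a limit pole; against [Pole i (Some n)] the
   robber escapes to a spoke beyond n, against a spoke to another spoke.
   On a spoke he waits as long as the cop is on a different spoke and otherwise
   returns to a limit pole.  Spokes being pairwise non-adjacent, he either stays
   on one spoke forever or visits one of the two limit poles infinitely often. *)
From HB Require Import structures.
From mathcomp Require Import all_boot finmap.
From mathcomp Require Import classical_sets cardinality.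
Require Import Defs.

Set Implicit Arguments.
Unset Strict Implicit.
Unset Printing Implicit Defensive.

Local Open Scope fset_scope.

(** * Building constructible sets by adding dominated vertices *)

Section Constructible.
Variable G : graph.
Implicit Types (U : {fset G}) (u v w : G) (s : seq G).

Lemma constructible1 v : constructible [fset v].
Proof.
exists 1, (fun=> v); split=> [i j _||k]; first by rewrite !ord1.
  apply/fsetP=> w; rewrite inE; apply/imfsetP/eqP=> [[]//|->].
  by exists ord0.
by rewrite ord1.
Qed.

(** Put [v] last in the ordering of [U]: earlier initial segments are untouched, and the only new
    requirement is that [u] dominates [v] in the enlarged set. *)
Lemma constructibleU1 U u v :
  constructible U -> u \in U -> v \notin U -> adj u v ->
  {in U, forall w, adj v w -> w != u -> adj u w} ->
  constructible (v |` U).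
Proof.
move=> [n [x [x_inj <- x_dom]]] uU vU uv dom_uv.
have xv j : x j != v by apply: contraNneq vU => <-; apply: in_imfset.
pose y (i : 'I_n.+1) := oapp x v (unlift ord_max i).
have y_max : y ord_max = v by rewrite /y unlift_none.
have y_lift j : y (lift ord_max j) = x j by rewrite /y liftK.
have bumpE (j : 'I_n) : bump n j = j by rewrite /bump leqNgt ltn_ord.
(* With [P] the bound [<= k] this computes every initial segment at once: [v] joins exactly those
   reaching the last index [n]. *)
have y_img (P : pred nat) (F := [fset x j | j : 'I_n & P j]) :
    [fset y j | j : 'I_n.+1 & P j] = if P n then v |` F else F.
  apply/fsetP=> w; apply/imfsetP/idP=> [[j /[swap] ->]|].
    case: (unliftP ord_max j) => [j'|] ->; rewrite ?y_max ?y_lift inE /= ?bumpE.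
      by move=> Pj; case: ifP => _; rewrite ?inE in_imfset ?orbT // inE.
    by move=> /= ->; rewrite !inE eqxx.
  have xF : w \in F -> exists2 j : 'I_n.+1, j \in [pred j | P (val j)] & w = y j.
    move=> /imfsetP [j /= Pj ->]; exists (lift ord_max j); rewrite ?y_lift //.
    by rewrite inE /= bumpE.
  case: ifP => // Pn; rewrite !inE => /orP [/eqP ->|//].
  by exists ord_max.
have y_imgT : [fset y j | j : 'I_n.+1] = v |` [fset x j | j : 'I_n].
  apply: etrans (etrans (y_img predT) _); first exact: eq_imfset.
  by congr fsetU; apply: eq_imfset.
exists n.+1, y; split=> //.
- move=> i j; case: (unliftP ord_max i) => [i'|] ->;
    case: (unliftP ord_max j) => [j'|] ->; rewrite ?y_max ?y_lift //.
  + by move=> /x_inj ->.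
  + by move=> /eqP; rewrite (negPf (xv _)).
  + by move=> /esym/eqP; rewrite (negPf (xv _)).
move=> k; rewrite (y_img (leq^~ k)); case: (unliftP ord_max k) => [k'|] ->.
  rewrite lift_max [n <= _]leqNgt ltn_ord /= => k_gt0.
  have [i ik dom] := x_dom _ k_gt0.
  by exists (lift ord_max i); rewrite ?lift_max // !y_lift.
move=> _; have /imfsetP [i _ u_i] := uU.
exists (lift ord_max i); first by rewrite lift_max ltn_ord.
rewrite y_max y_lift -u_i leqnn.
have -> : [fset x j | j : 'I_n & j <= @ord_max n] = [fset x j | j : 'I_n].
  by apply: eq_imfset => // j; rewrite !inE ltnW // ltn_ord.
split; rewrite ?inE ?eqxx ?uU ?orbT //.
  by apply: contraTneq uv => ->; rewrite adj_irrefl.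
apply/fsubsetP=> w; rewrite !inE /=.
case: (w =P v) => [->|_] /=; first by rewrite uv orbT.
move=> /andP [wU vw]; rewrite wU /=; case: eqP => //= /eqP wu.
exact: dom_uv.
Qed.

Lemma in_fsetU_seq U s v : (v \in U `|` [fset w in s]) = (v \in U) || (v \in s).
Proof. by rewrite !inE. Qed.

(** Vertices of [s] are added one by one. Each dominator lies in [U] and is tested against all of
    [U] and [s], so it works at every intermediate stage, and a vertex already present changes
    nothing. *)
Lemma constructible_cat U s :
  constructible U ->
  {in s, forall v, exists u, [/\ u \in U, adj u v &
    forall w, w \in U \/ w \in s -> adj v w -> w != u -> adj u w]} ->
  constructible (U `|` [fset v in s]).
Proof.
move=> cU; elim: s => [|v s IHs] dom.
  suff -> : U `|` [fset v in [::]] = U by [].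
  by apply/fsetP=> w; rewrite !inE orbF.
have cUs : constructible (U `|` [fset v in s]).
  apply: IHs => w ws; have [|u [uU uw dom_u]] := dom w.
    by rewrite inE ws orbT.
  exists u; split=> // t ts; apply: dom_u.
  by case: ts => ts; [left|right; rewrite inE ts orbT].
have -> : U `|` [fset w in v :: s] = v |` (U `|` [fset w in s]).
  by apply/fsetP=> w; rewrite !inE; do !case: (_ \in _) => //=; rewrite ?orbT.
case: (boolP (v \in U `|` [fset w in s])) => [vU|vU].
  suff -> : v |` (U `|` [fset w in s]) = U `|` [fset w in s] by [].
  by apply/fsetUidPr; rewrite fsub1set.
have [|u [uU uv dom_u]] := dom v; first exact: mem_head.
apply: (constructibleU1 cUs) uv _ => //; first by rewrite inE uU.
move=> w; rewrite !inE /= => /orP ws; apply: dom_u.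
by case: ws => ws; [left|right; rewrite inE ws orbT].
Qed.

End Constructible.

(** * The spindle graph and its connectedness *)

Inductive vert := Apex | Spoke of nat | Pole of bool & option nat.

Definition vert_code v : option (nat + bool * option nat) :=
  match v with
  | Apex => None
  | Spoke z => Some (inl z)
  | Pole i k => Some (inr (i, k))
  end.

Definition vert_decode c : vert :=
  match c with
  | None => Apex
  | Some (inl z) => Spoke z
  | Some (inr (i, k)) => Pole i k
  end.

Lemma vert_codeK : cancel vert_code vert_decode.
Proof. by case. Qed.

HB.instance Definition _ := Choice.copy vert (can_type vert_codeK).

(* In [Pole i k], [k = None] stands for the limit k = infinity. *)
Definition vadj (u v : vert) : bool :=
  match u, v with
  | Apex, Apex | Spoke _, Spoke _ => false
  | Apex, Spoke _ | Spoke _, Apex => true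
  | Apex, Pole _ k | Pole _ k, Apex => isSome k
  | Spoke z, Pole _ k | Pole _ k, Spoke z => if k is Some m then z <= m else true
  | Pole i k, Pole j l => (i == j) && (k != l)
  end.

Lemma vadj_sym : symmetric vadj.
Proof.
by case=> [|z|i k] [|w|j l] //=; rewrite eq_sym [k == _]eq_sym.
Qed.

Lemma vadj_irrefl : irreflexive vadj.
Proof. by case=> [|z|i k] //=; rewrite !eqxx. Qed.

Lemma vadj_path_to_Apex (v : vert) : exists2 p, path vadj v p & last v p = Apex.
Proof.
case: v => [|z|i [k|]]; first by exists [::].
- by exists [:: Apex].
- by exists [:: Apex].
- by exists [:: Spoke 0; Apex].
Qed.

Lemma vadj_connected (u v : vert) : exists2 p, path vadj u p & last u p = v.
Proof.
have [p up pA] := vadj_path_to_Apex u; have [q vq qA] := vadj_path_to_Apex v.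
exists (p ++ rev (belast v q)).
  rewrite cat_path up pA -qA rev_path.
  by rewrite (eq_path (e' := vadj)) // => x y; rewrite vadj_sym.
by rewrite last_cat pA -qA; case: q {vq qA} => //= w q; rewrite rev_cons last_rcons.
Qed.

Definition spindle : graph :=
  Graph vadj_sym vadj_irrefl (inhabits Apex) vadj_connected.

(** * Finite balls and local constructibility *)

Definition level (v : vert) : nat :=
  match v with
  | Apex | Pole _ None => 0
  | Spoke z => z
  | Pole _ (Some k) => k
  end.

Definition inner n : seq spindle :=
  [seq Spoke z | z <- iota 0 n.+1] ++
  [seq Pole i (Some k) | i <- [:: false; true], k <- iota 0 n.+1].

Definition ends : seq spindle := [:: Pole false None; Pole true None].

(** [Apex] and both limit poles belong to every ball, which is why [level] sends them to 0. *)
Definition ball n : {fset spindle} :=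
  [fset (Apex : spindle)] `|` [fset v in inner n] `|` [fset v in ends].

Lemma mem_inner n (v : spindle) :
  (v \in inner n) = (level v <= n) &&
     match v with Spoke _ | Pole _ (Some _) => true | _ => false end.
Proof.
rewrite mem_cat; apply/orP/idP.
  case=> [/mapP [z]|/allpairsP [[i k] [_]]]; rewrite mem_iota => vn -> //=;
  by rewrite andbT.
case: v => [|z|i [k|]] /andP [] // vn _.
  by left; apply: (@map_f nat spindle Spoke); rewrite mem_iota.
right; apply: (@allpairs_f _ _ spindle (fun i k => Pole i (Some k))).
  by case: i {vn}.
by rewrite mem_iota.
Qed.

Lemma ball_constructible n : constructible (ball n).
Proof.
apply: constructible_cat => [|v v_end].
  apply: constructible_cat => [|v v_in]; first exact: constructible1.
  exists (Apex : spindle); rewrite inE; split=> // [|w [w_in|w_in] _].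
  - by move: v_in; rewrite mem_inner; case: v => [|z|i [k|]] //=; rewrite andbF.
  - by move/fset1P: w_in => ->; rewrite eqxx.
  - by move: w_in; rewrite mem_inner /=; case: w => [|z|i [k|]] //=.
have [i ->] : exists i, v = Pole i None.
  by move: v_end; rewrite !inE => /orP [] /eqP ->; [exists false|exists true].
(* Spokes of the ball have index at most [n], so this pole sees them all; in the whole graph no
   finite pole sees every spoke. *)
exists (Pole i (Some n) : spindle); split.
- by rewrite in_fsetU_seq mem_inner /= leqnn orbT.
- by rewrite /= eqxx.
move=> w; rewrite in_fsetU_seq mem_inner !inE; case: w => [|z|j [k|]] //=.
- by rewrite andbT => -[].
- by move=> _ /andP [/eqP -> _]; rewrite eqxx eq_sym; apply: contraNneq => ->.
- by move=> _; rewrite andbF.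
Qed.

Lemma spindle_locally_constructible : locally_constructible spindle.
Proof.
move=> A; pose n := \max_(v <- A) level v.
exists (ball n); last exact: ball_constructible.
apply/fsubsetP=> v vA; have vn : level v <= n by apply: leq_bigmax_seq.
rewrite !in_fsetU_seq mem_inner vn !inE.
by case: v {vA vn} => [|z|[] [k|]]; rewrite /= ?orbT.
Qed.

(** * Safe positions and the robber's answers *)

(* Stronger than the cop at [c] not threatening [r]: an answer to every cop move
   must remain possible, whence [k < z] for a robber on [Spoke z]. *)
Definition safe (c r : vert) : bool :=
  match r, c with
  | Pole _ None, Apex => true
  | Pole i None, Pole j _ => i != j
  | Spoke z, Spoke w => z != w
  | Spoke z, Pole _ (Some k) => k < z
  | _, _ => false
  end.

Definition start (c : vert) : vert :=
  match c with
  | Apex => Pole false None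
  | Spoke w => Spoke w.+1
  | Pole j _ => Pole (~~ j) None
  end.

(** The value [Spoke 0] is a placeholder: no legal move from a [safe] position puts the cop on the
    robber's limit pole. *)
Definition evade (r c : vert) : vert :=
  match r, c with
  | Pole _ None, Spoke w => Spoke w.+1
  | Pole i None, Pole j k =>
    if i == j then Spoke (if k is Some m then m.+1 else 0) else r
  | Spoke _, Apex => Pole false None
  | Spoke _, Pole j _ => Pole (~~ j) None
  | _, _ => r
  end.

Lemma evade_legal r c : (evade r c == r) || vadj r (evade r c).
Proof.
case: r c => [|z|i [k|]] [|w|j l] //=; rewrite ?eqxx //.
by case: ifP; rewrite ?eqxx.
Qed.

Lemma start_safe c : safe c (start c).
Proof. by case: c => [|w|[] k] //=; rewrite gtn_eqF. Qed.

Lemma safe_neq c r : safe c r -> c != r.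
Proof.
by case: c r => [|w|i [k|]] [|z|j [l|]] //=; apply: contraNneq => -[->].
Qed.

Lemma safe_nadj c r : safe c r -> ~~ vadj c r.
Proof.
case: c r => [|w|i [k|]] [|z|j [l|]] //=; rewrite -?ltnNge //.
- by rewrite andbT eq_sym.
- by rewrite andbF.
Qed.

Lemma evade_safe c c' r :
  safe c r -> (c' == c) || vadj c c' -> safe c' (evade r c').
Proof.
case: r => [|z|i [k|]] //.
  case: c' => [|w|j l] //=; last by case: j.
  case: c => [|w'|j [k|]] //=; last 1 first.
    (* From [Pole j (Some k)] the cop reaches only spokes of index at most [k], hence not the
       robber's spoke, as [k < z]. *)
    by move=> kz /=; apply: contraTneq => <-; rewrite -ltnNge.
  by rewrite orbF => zw' /eqP [->].
case: c' => [|w|j l] //=; first by rewrite gtn_eqF.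
case: c => [|w|j' m] //=.
  (* From [Apex] the cop can enter only a finite pole, so a spoke beyond its index is available. *)
  by case: l => //= l _ _; case: ifP => //= ->.
move=> ij' /orP [/eqP [-> _]|/andP [/eqP <- _]];
  by rewrite (negPf ij') /= ij'.
Qed.

(** * The robber's play against a fixed cop strategy *)

Section Evasion.
Variable s : cop_strategy spindle.

Definition reply (h : seq spindle) : spindle :=
  if h is v :: h' then evade (last v h') (s h) else start (s h).

(** The strategy reads the whole list of robber positions, so the recursion runs on lists rather
    than on single positions. *)
Definition history n : seq spindle := iter n (fun h => rcons h (reply h)) [::].

(** The default [Apex] is never returned, since [history n.+1] is nonempty. *)
Definition robber n : spindle := last Apex (history n.+1).

Lemma mkseq_robber n : mkseq robber n = history n.
Proof.
elim: n => // n IHn; rewrite mkseqS IHn.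
by rewrite /robber [history n.+1]iterS last_rcons.
Qed.

Lemma copE n : cop s robber n = s (history n).
Proof. by rewrite /cop mkseq_robber. Qed.

Lemma robber0 : robber 0 = start (cop s robber 0).
Proof. by []. Qed.

Lemma robberS n : robber n.+1 = evade (robber n) (cop s robber n.+1).
Proof.
rewrite copE /robber [history n.+2]iterS last_rcons -/(history n.+1).
have : 0 < size (history n.+1) by rewrite [history _]iterS size_rcons.
by case: (history n.+1).
Qed.

Lemma robber_legal : legal_walk robber.
Proof. by move=> n; rewrite robberS; exact: evade_legal. Qed.

Hypothesis s_legal : legal_strategy s.

Lemma robber_safe n : safe (cop s robber n) (robber n).
Proof.
elim: n => [|n IHn]; first by rewrite robber0 start_safe.
by rewrite robberS; apply: evade_safe IHn _; apply: s_legal robber_legal n.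
Qed.

(** A capture would be a legal cop move onto the robber's current vertex, but [safe] makes the two
    positions distinct and non-adjacent. *)
Lemma robber_not_caught : ~ caught s robber.
Proof.
move=> [n caught_n].
have := s_legal robber_legal n; rewrite caught_n.
have safe_n := robber_safe n.
by rewrite eq_sym (negPf (safe_neq safe_n)) /= (negPf (safe_nadj safe_n)).
Qed.

Lemma finite_visits (v : spindle) : visits_finitely_often robber v ->
  exists N, forall n, N <= n -> robber n != v.
Proof.
move=> /finite_fsetP [X XE]; exists (\max_(n <- X) n).+1 => n Nn.
apply/eqP=> rn; have nX : n \in X.
  by have : [set n | robber n = v]%classic n by []; rewrite XE.
by move: Nn; rewrite ltnNge leq_bigmax_seq.
Qed.

Lemma robber_recurrent : ~ forall v, visits_finitely_often robber v.
Proof.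
move=> fin.
have [N0 far0] := finite_visits (fin (Pole false None)).
have [N1 far1] := finite_visits (fin (Pole true None)).
pose N := maxn N0 N1.
have on_spoke n : N <= n -> exists z, robber n = Spoke z.
  rewrite geq_max => /andP [/far0 r0 /far1 r1].
  have := robber_safe n; case: (robber n) r0 r1 => [|z|[] [k|]] //= _ _ _.
  by exists z.
(* A legal step between two spokes can only be a pause. *)
have const n : robber (N + n)%N = robber N.
  elim: n => [|n <-]; first by rewrite addn0.
  have [z rz] := on_spoke (N + n)%N (leq_addr _ _).
  have [z' rz'] := on_spoke (N + n.+1)%N (leq_addr _ _).
  have := robber_legal (N + n)%N; rewrite -addnS rz rz' /= orbF.
  by move/eqP.
have [M farM] := finite_visits (fin (robber N)).
by have := farM (N + M)%N (leq_addl _ _); rewrite const eqxx.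
Qed.

End Evasion.

Theorem theorem7 :
  exists G : graph, locally_constructible G /\ ~ weak_cop_win G.
Proof.
exists spindle; split; first exact: spindle_locally_constructible.
move=> [s s_legal /(_ _ (robber_legal s)) [|]].
  exact: robber_not_caught.
exact: robber_recurrent.
Qed.
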